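(* Let $\lambda$ be a singular strong limit cardinal with $\mathrm{cf}(\lambda)=\sigma$, and let $\kappa$ be a regular cardinal with $\sigma<\kappa<\lambda$. Then there is a stationary subset $S$ of $[\lambda]^{<\kappa}$ such that every unbounded subset of $S$ is stationary.
   Context: For a regular uncountable cardinal $\kappa\le\lambda$: $[\lambda]^{<\kappa}$ is the set of subsets of $\lambda$ of cardinality $<\kappa$. For a model $\mathcal{M}$ with universe $\lambda$ and countable vocabulary and $a\subseteq\lambda$, $\mathrm{cl}_{\mathcal{M}}(a)$ denotes the closure of $a$ under the functions (including constants) of $\mathcal{M}$. A club of $[\lambda]^{<\kappa}$ is a set of the form $\mathcal{C}_{\mathcal{M}}=\{a\in[\lambda]^{<\kappa}: a=\mathrm{cl}_{\mathcal{M}}(a)\ \wedge\ a\cap\kappa\in\kappa\}$ for some model $\mathcal{M}$ with universe $\lambda$ and countable vocabulary. The club filter $\mathcal{E}_{\lambda,\kappa}$ is the filter on $[\lambda]^{<\kappa}$ generated by the clubs. A set $S\subseteq[\lambda]^{<\kappa}$ is stationary if $[\lambda]^{<\kappa}\setminus S\notin\mathcal{E}_{\lambda,\kappa}$ (equivalently, $S$ meets every club), and non-stationary otherwise. A set $S\subseteq[\lambda]^{<\kappa}$ is unbounded if every member of $[\lambda]^{<\kappa}$ is contained in some member of $S$. *)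

(* Defs.v *)
From mathcomp Require Import all_boot all_order all_classical.

Set Implicit Arguments.
Unset Strict Implicit.
Unset Printing Implicit Defensive.

Local Open Scope classical_set_scope.
Local Open Scope card_scope.
Local Open Scope order_scope.

Definition card_lt (T U : Type) (A : set T) (B : set U) : Prop :=
  A #<= B /\ ~ (B #<= A).

(* Inside a well-ordered type L, the ordinals up to the order type of L are
   the down-closed subsets of L: a proper one is [below x] for a unique x, the
   whole of L is the greatest one, and the ordinal [below x] is a member of the
   ordinal A iff [A x]. *)
Section Ordinals.
Context {d : Order.disp_t} {L : orderType d}.
Implicit Types (A C X : set L) (x y : L).

Definition below x : set L := [set y | y < x].

Definition is_ordinal A : Prop := forall x y, A x -> y <= x -> A y.

(* Cardinals are the initial ordinals. *)
Definition is_cardinal A : Prop :=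
  is_ordinal A /\ forall x, A x -> card_lt (below x) A.

Definition cofinal_in A X : Prop :=
  X `<=` A /\ forall x, A x -> exists2 y, X y & x <= y.

(* cf(A) = C: the cardinal C is the least size of a cofinal subset of A. *)
Definition has_cf A C : Prop :=
  [/\ is_cardinal C,
      exists2 X, cofinal_in A X & X #= C
    & forall X, cofinal_in A X -> C #<= X].

Definition regular_cardinal A : Prop :=
  [/\ is_cardinal A, infinite_set A & has_cf A A].

Definition singular_cardinal A : Prop :=
  [/\ is_cardinal A, infinite_set A & ~ has_cf A A].

Definition strong_limit_cardinal A : Prop :=
  is_cardinal A /\
  forall x, A x -> is_cardinal (below x) ->
    card_lt [set X : set L | X `<=` below x] A.

End Ordinals.

Record vocabulary := Vocabulary {
  fun_symb : countType;
  fun_arity : fun_symb -> nat;  (* constants have arity 0 *)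
  rel_symb : countType;
  rel_arity : rel_symb -> nat
}.

Record model (U : Type) := Model {
  voc : vocabulary;
  fun_interp : forall f : fun_symb voc, (fun_arity f).-tuple U -> U;
  rel_interp : forall r : rel_symb voc, (rel_arity r).-tuple U -> Prop
}.

Section Closure.
Context {U : Type} (M : model U).

Definition closed_under (a : set U) : Prop :=
  forall (f : fun_symb (voc M)) (t : (fun_arity f).-tuple U),
    (forall i, a (tnth t i)) -> a (fun_interp t).

Definition cl (a : set U) : set U := smallest closed_under a.

End Closure.

Section ClubFilter.
Context {d : Order.disp_t} {L : orderType d} (kappa : L).

(* The space [lambda]^{<kappa}, with lambda = L and kappa = below kappa. *)
Definition Pkl : Type := {a : set L | card_lt a (below kappa)}.

Implicit Types S : set Pkl.

(* The second condition says that a meets kappa in an ordinal below kappa. *)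
Definition club_of (M : model L) : set Pkl :=
  [set a | sval a = cl M (sval a) /\
           exists2 x, x < kappa & sval a `&` below kappa = below x].

Definition is_club S : Prop := exists M : model L, S = club_of M.

Definition club_filter : set (set Pkl) := smallest Filter is_club.

Definition stationary S : Prop := ~ club_filter (~` S).

Definition unbounded S : Prop :=
  forall a : Pkl, exists2 b : Pkl, S b & sval a `<=` sval b.

End ClubFilter.

(* Main.v *)
(* Since lambda is a strong limit, the restriction of a function to a bounded
   part of lambda can be coded by a single element of lambda. Let S consist of
   the b that meet kappa in an ordinal and are closed under all the partial
   functions coded in b. A model M is determined by the codes of its functions
   restricted to [below x], for x in a cofinal set of size cf(lambda) < kappa;
   these codes form a set a in [lambda]^{<kappa}, and every b in S containing a
   belongs to the club of M. Hence S minus a club is never unbounded, and the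
   usual closure argument makes S itself unbounded. *)
Require Import Defs.
From mathcomp Require Import all_boot all_order all_classical wochoice.

Set Implicit Arguments.
Unset Strict Implicit.
Unset Printing Implicit Defensive.

Import Order.TTheory.
Local Open Scope card_scope.
Local Open Scope order_scope.
Local Open Scope classical_set_scope.

(** * Injections, power sets and pairs *)

Definition subsets (U : Type) (A : set U) : set (set U) := [set X | X `<=` A].

Definition seqs (U : eqType) (A : set U) : set (seq U) :=
  [set t | [set` t] `<=` A].

Lemma card_le_inj (T U : Type) (A : set T) (B : set U) (f : T -> U) :
  {in A &, injective f} -> f @` A `<=` B -> A #<= B.
Proof.
by move=> /inj_card_eq fA fB; rewrite -(card_le_eql fA); exact: subset_card_le.
Qed.

(** The injection behind [#<=] lives on subtypes; a point of [A] supplies the default that extends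
    it to all of [T]. *)
Lemma card_le_exinj (T U : Type) (A : set T) (B : set U) : A !=set0 ->
  A #<= B -> exists f : T -> U, {in A &, injective f} /\ f @` A `<=` B.
Proof.
move=> [a Aa] /card_leP[f].
pose g x := if pselect (A x) is left Ax then set_val (f (SigSub (mem_set Ax)))
  else set_val (f (SigSub (mem_set Aa))).
exists g; split=> [x y|_ [x Ax <-]]; last first.
  by rewrite /g; case: pselect => // Ax'; exact: set_valP.
move=> /set_mem Ax /set_mem Ay.
rewrite /g; case: pselect => // Ax'; case: pselect => // Ay' /val_inj.
by move=> /(@inj _ _ _ f _ _ (in_setT _) (in_setT _)) [].
Qed.

Lemma card_le_subsets (T U : Type) (A : set T) (B : set U) :
  A #<= B -> subsets A #<= subsets B.
Proof.
have [->|/set0P A0 /(card_le_exinj A0)[f [finj fB]]] := eqVneq A set0.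
  move=> _; apply: (@card_le_inj _ _ _ _ (fun=> set0)) => [X Y|_ [X _ <-]//].
  by rewrite !inE /subsets /= !subset0 => -> ->.
apply: (@card_le_inj _ _ _ _ (fun X => f @` X)) => [|_ [X XA <-]]; last first.
  by apply: subset_trans fB; exact: image_subset.
have sub X Y : X `<=` A -> Y `<=` A -> f @` X = f @` Y -> X `<=` Y.
  move=> XA YA XY x Xx; have [y Yy] : (f @` Y) (f x) by rewrite -XY; exists x.
  by move=> /finj<- //; apply/mem_set; [exact: YA|exact: XA].
move=> X Y /set_mem XA /set_mem YA XY.
by apply/seteqP; split; apply: sub.
Qed.

Definition kpair (U : Type) (a b : U) : set (set U) :=
  [set [set a]; [set a; b]].

Lemma kpair_inj (U : Type) (a b a' b' : U) :
  kpair a b = kpair a' b' -> a = a' /\ b = b'.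
Proof.
move=> E.
have aa : a = a'.
  have : kpair a b [set a'] by rewrite E; left.
  by case=> E'; have : [set a'] a by rewrite E' //=; left.
subst a'; split=> //.
have : kpair a b' [set a; b] by rewrite -E; right.
have : kpair a b [set a; b'] by rewrite E; right.
have sub c c' : kpair a c [set a; c'] -> c' = a \/ c' = c.
  by case=> E'; have : [set a; c'] c' by [right]; rewrite E' /=; [left|].
by move=> /sub[->|->] // /sub[->|->].
Qed.

Lemma card_le_lt (T U V : Type) (A : set T) (B : set U) (C : set V) :
  A #<= B -> card_lt B C -> card_lt A C.
Proof.
move=> AB [BC CB]; split; first exact: card_le_trans AB BC.
by move=> CA; apply: CB; exact: card_le_trans CA AB.
Qed.

(** * Comparing sets with ordinals of a well-order *)

Section WellOrdered.
Context {d : Order.disp_t} {L : orderType d}.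
Hypothesis wo : well_order (@Order.le d L).
Implicit Types (O X : set L) (x y : L).

Lemma ex_least (P : set L) : P !=set0 ->
  exists x, P x /\ forall y, P y -> x <= y.
Proof.
case=> x Px; have [|z [[Pz zmin] _]] := wo (A := [pred x | `[< P x >]]).
  by exists x; apply/asboolP.
exists z; split; first exact/asboolP.
by move=> y Py; apply: zmin; apply/asboolP.
Qed.

Lemma lt_wf : well_founded (fun x y : L => x < y).
Proof.
move=> x; apply: contrapT => nx.
have [z [nz zmin]] := ex_least (ex_intro (fun x => ~ Acc _ x) x nx).
apply: nz; constructor=> y yz; apply: contrapT => /zmin.
by rewrite leNgt yz.
Qed.

(* Send the ordinals successively to new elements of [A] until [A] is
   exhausted. *)
Lemma card_le_ordinal O (U : Type) (A : set U) : is_ordinal O ->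
  O #<= A \/ exists2 x, O x & A #<= below x.
Proof.
move=> ordO; have [->|/set0P[a0 _]] := eqVneq A set0.
  have [->|/set0P[x Ox]] := eqVneq O set0; first by left; exact: card_ge0.
  by right; exists x => //; exact: card_ge0.
pose fresh x (r : forall y, y < x -> U) a :=
    A a /\ forall y (yx : y < x), r y yx <> a.
pose step x (r : forall y, y < x -> U) : U :=
  if pselect (exists a, fresh x r a) is left h then projT1 (cid h) else a0.
pose f := Fix lt_wf (fun=> U) step.
have fE x : f x = step x (fun y _ => f y).
  rewrite /f Fix_eq // => {}x r r' rr'; congr step.
  by do 2!apply: functional_extensionality_dep => ?.
have [ex|/existsNP[x /not_implyP[Ox nex]]] :=
    pselect (forall x, O x -> exists a, fresh x (fun y _ => f y) a).
  left.
  have fP x : O x -> fresh x (fun y _ => f y) (f x).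
    move=> /ex h; rewrite fE /step; case: pselect => // h'.
    exact: projT2 (cid h').
  have finj : {in O &, injective f}.
    move=> x y /set_mem Ox /set_mem Oy fxy; case: (ltgtP x y) => // xy.
      by have [_ /(_ x xy)] := fP _ Oy.
    by have [_ /(_ y xy)/(_ (esym fxy))] := fP _ Ox.
  by apply: card_le_inj finj _ => _ [x /fP[Afx _] <-].
right; exists x => //.
apply: card_le_trans (card_image_le f (below x)).
apply: subset_card_le => a Aa; apply: contrapT => na; apply: nex.
by exists a; split=> // y yx fya; apply: na; exists y.
Qed.

Lemma card_ltP O (U : Type) (A : set U) : is_cardinal O ->
  card_lt A O <-> exists2 x, O x & A #<= below x.
Proof.
move=> [ordO cardO]; split=> [[AO OA]|[x /cardO xO Ax]].
  by have [] := card_le_ordinal A ordO.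
exact: card_le_lt Ax xO.
Qed.

(** * Sets smaller than a regular cardinal *)

Section Regular.
Context (O : set L).
Hypothesis regO : regular_cardinal O.

Lemma card_lt_countable (U : Type) (A : set U) :
  card_lt [set: nat] O -> countable A -> card_lt A O.
Proof. by move=> natO cA; exact: card_le_lt cA natO. Qed.

(** If [O] embedded into the union, the part of [O] sent into a single [B i] would be too small to
    be cofinal, hence bounded by some [s i]. These bounds would form a cofinal subset of [O] no
    larger than [D], against regularity. *)
Lemma card_lt_bigcup (I U : Type) (D : set I) (B : I -> set U) :
  card_lt D O -> (forall i, D i -> card_lt (B i) O) ->
  card_lt (\bigcup_(i in D) B i) O.
Proof.
case: regO => cardO infO [_ _ cofO] ltD ltB.
apply/(card_ltP _ cardO).
case: (card_le_ordinal (\bigcup_(i in D) B i) (proj1 cardO)) => // OU; exfalso.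
have [x0 Ox0] := infinite_setN0 infO.
have [g [ginj gU]] := card_le_exinj (ex_intro _ x0 Ox0) OU.
pose F i := [set x | O x /\ B i (g x)].
have ub i : exists s, D i -> O s /\ forall y, F i y -> y < s.
  have [Di|nDi] := pselect (D i); last by exists x0.
  apply: contrapT => nub; have [_ OB] := ltB _ Di; apply: OB.
  apply: (@card_le_trans _ _ _ (F i)).
    apply: cofO; split=> [x []//|x Ox]; apply: contrapT => nx.
    apply: nub; exists x => _; split=> // y Fy; rewrite ltNge; apply/negP => xy.
    by apply: nx; exists y.
  have Finj : {in F i &, injective g}.
    by move=> x y /set_mem[Ox _] /set_mem[Oy _]; apply: ginj; exact: mem_set.
  by apply: card_le_inj Finj _ => _ [x [_ Bx] <-].
have [s sP] := choice ub.
have [_] := ltD; apply; apply: card_le_trans (card_image_le s D).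
apply: cofO; split=> [_ [i /sP[Os _] <-]//|x Ox].
have [i Di Bi] : (\bigcup_(i in D) B i) (g x) by apply: gU; exists x.
by exists (s i); [exists i|apply: ltW; apply: (sP i Di).2].
Qed.

Hypothesis natO : card_lt [set: nat] O.

Lemma card_lt_setU (U : Type) (A B : set U) :
  card_lt A O -> card_lt B O -> card_lt (A `|` B) O.
Proof.
move=> ltA ltB; rewrite -bigcup2inE; apply: card_lt_bigcup.
  exact: card_lt_countable natO (countableP _).
by move=> [|[|i]] //= _.
Qed.

(** Induction on the length: prepending an entry costs one union over [A], and collecting all
    lengths one countable union. *)
Lemma card_lt_seqs (A : set L) : card_lt A O -> card_lt (seqs A) O.
Proof.
move=> ltA; pose T n := [set t | seqs A t /\ size t = n].
apply: (@card_le_lt _ _ _ _ (\bigcup_n T n)).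
  by apply: subset_card_le => t At; exists (size t).
apply: card_lt_bigcup => // n _; elim: n => [|n IH].
  apply: card_lt_countable natO _; apply: sub_countable (countable1 [::]).
  by apply: subset_card_le => t [_ /size0nil].
apply: (@card_le_lt _ _ _ _ (\bigcup_(x in A) (cons x @` T n))).
  apply: subset_card_le => -[|x t] [At]//= [sz].
  exists x; first by apply: At; rewrite /= inE eqxx.
  exists t => //; split=> // y yt; apply: At => /=; rewrite inE.
  by apply/orP; right.
by apply: card_lt_bigcup => // x _; exact: card_le_lt (card_image_le _ _) IH.
Qed.

End Regular.

(** The hull is a union of countably many enlargements of [a]; regularity and uncountability of
    [kappa] keep it small. *)
Lemma ex_closed_superset (kappa : L) (g : L -> L -> seq L -> L) (a : set L) :
  regular_cardinal (below kappa) -> card_lt [set: nat] (below kappa) ->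
  card_lt a (below kappa) ->
  exists b : set L, [/\ a `<=` b, card_lt b (below kappa),
    forall x c t, b x -> b c -> seqs b t -> b (g x c t)
  & exists2 z, z < kappa & b `&` below kappa = below z].
Proof.
move=> regK natK lta.
(* Adding [below x] fills the gaps under members of [kappa], so that the limit meets [kappa] in an
   initial segment. *)
pose step b := b `|` \bigcup_(x in b `&` below kappa) below x
  `|` \bigcup_(x in b) \bigcup_(c in b) (g x c @` seqs b).
pose s n := iter n step a.
have [cardK _ _] := regK.
have lts n : card_lt (s n) (below kappa).
  elim: n => // n IH; rewrite /s /= -/(s n).
  apply: card_lt_setU => //; first apply: card_lt_setU => //.
    apply: card_lt_bigcup => //; last by move=> x [_ /(proj2 cardK)].
    by apply: card_le_lt IH; apply: subset_card_le => x [].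
  apply: card_lt_bigcup => // x _; apply: card_lt_bigcup => // c _.
  by apply: card_le_lt (card_image_le _ _) _; exact: card_lt_seqs.
have sS n : s n `<=` s n.+1 by move=> x sx; left; left.
have sM m n : (m <= n)%N -> s m `<=` s n.
  elim: n => [|n IH]; first by rewrite leqn0 => /eqP->.
  rewrite leq_eqVlt => /orP[/eqP->//|/IH mn x /mn]; exact: sS.
pose b := \bigcup_n s n.
have ltb : card_lt b (below kappa) by exact: card_lt_bigcup.
exists b; split=> //.
- by move=> x ax; exists 0%N.
- move=> x c t [m _ mx] [n _ nc] bt.
  (* The stages increase, so a finite sequence in their union lies in a single stage. *)
  have [k kt] : exists k, seqs (s k) t.
    elim: t bt => [|y t IH] bt; first by exists 0%N.
    have [k kt] : exists k, seqs (s k) t.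
      by apply: IH => z zt; apply: bt; rewrite /= inE; apply/orP; right.
    have [l _ ly] : b y by apply: bt; rewrite /= inE eqxx.
    exists (maxn k l) => z /=; rewrite inE => /orP[/eqP->|zt].
      exact: sM (leq_maxr _ _) _ ly.
    exact: sM (leq_maxl _ _) _ (kt _ zt).
  pose N := maxn (maxn m n) k.
  exists N.+1 => //; right; exists x.
    by apply: sM mx; rewrite /N -maxnA leq_maxl.
  exists c; first by apply: sM nc; rewrite /N maxnAC leq_maxr.
  by exists t => // z /kt; apply: sM; exact: leq_maxr.
(* Being smaller than [kappa], [b] misses a point of [kappa]; the least one is the ordinal in which
   [b] meets [kappa]. *)
have [z [[zK nz] zmin]] : exists z, (below kappa `\` b) z /\
    forall y, (below kappa `\` b) y -> z <= y.
  apply: ex_least; apply/set0P/eqP => K0; case: ltb => _; apply.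
  by apply: subset_card_le; rewrite -setD_eq0.
exists z => //; apply/seteqP; split=> [x [[n _ nx] xK]|x xz].
  rewrite /below /= ltNge; apply/negP; rewrite le_eqVlt => /orP[/eqP zx|zx].
    by apply: nz; rewrite zx; exists n.
  by apply: nz; exists n.+1 => //; left; right; exists x.
have xK : below kappa x by exact: lt_trans xz zK.
split=> //; apply: contrapT => nx; have := zmin x (conj xK nx).
by rewrite leNgt xz.
Qed.

(** * Coding bounded functions under a strong limit *)

Section StrongLimit.
Hypothesis slim : strong_limit_cardinal [set: L].

(** The strong limit property speaks only of cardinals [below y]; the least [y] for which [A] embeds
    into [below y] gives one. *)
Lemma card_lt_subsets (U : Type) (A : set U) :
  card_lt A [set: L] -> card_lt (subsets A) [set: L].
Proof.
have [cardL limL] := slim.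
move=> /(card_ltP _ cardL)[x _ Ax].
have [y [Ay ymin]] := ex_least (ex_intro (fun x => A #<= below x) x Ax).
apply: card_le_lt (card_le_subsets Ay) (limL y I _).
split=> [z t zy tz|z zy]; first exact: le_lt_trans tz zy.
split; first by apply: subset_card_le => t tz; exact: lt_trans tz zy.
by move=> yz; have := ymin z (card_le_trans Ay yz); rewrite leNgt zy.
Qed.

(** If [x] were largest, [below] would embed the whole order into the power set of [below x], which
    is smaller. *)
Lemma strong_limit_no_max x : exists y, x < y.
Proof.
apply: contrapT => /forallNP nx.
have [[_ cardL] _] := slim.
have [_] := card_lt_subsets (cardL x I); apply.
have inj : {in [set: L] &, injective below}.
  move=> y z _ _ /predeqP yz; apply/eqP; rewrite eq_le !leNgt.
  apply/andP; split; apply/negP.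
    by move=> /(proj1 (yz z)); rewrite /below /= ltxx.
  by move=> /(proj2 (yz y)); rewrite /below /= ltxx.
apply: card_le_inj inj _ => _ [y _ <-] z zy; apply: lt_le_trans zy _.
by rewrite leNgt; apply/negP.
Qed.

(* A sequence is coded by the set of the Kuratowski pairs (i, t_i), so that three
   power sets suffice and no cardinal multiplication is needed. *)
Lemma card_lt_seqs_below (x kappa : L) : infinite_set (below kappa) ->
  card_lt (seqs (below x)) [set: L].
Proof.
move=> /infiniteP/(card_le_exinj (ex_intro _ 0%N I))[e [einj eK]].
have [cardL _] := slim.
pose y := Order.max x kappa.
pose enc (s : seq L) : set (set (set L)) :=
  [set p | exists i v, onth s i = Some v /\ p = kpair (e i) v].
apply: (@card_le_lt _ _ _ _ (subsets (subsets (subsets (below y)))));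
  last first.
  by do 3!apply: card_lt_subsets; apply: (proj2 cardL).
have encP s i v : onth s i = Some v <-> enc s (kpair (e i) v).
  split=> [siv|[j [w [sjw ejw]]]]; first by exists i, v.
  have [eij ->] := kpair_inj ejw.
  by rewrite (einj _ _ (in_setT _) (in_setT _) eij).
have inj : {in seqs (below x) &, injective enc}.
  move=> s t _ _ st; apply: eq_from_onth => i.
  case E: (onth t i) => [v|]; first by apply/encP; rewrite st; apply/encP.
  case F: (onth s i) => [v|//].
  by move/encP: F; rewrite st => /encP; rewrite E.
apply: card_le_inj inj _ => _ [s sx <-] _ [i [v [siv ->]]].
have yv : below y v.
  have : below x v.
    by apply: sx; apply/onthP; exists i.
  by rewrite /below /= lt_max => ->.
have ye : below y (e i).
  have : below kappa (e i) by apply: eK; exists i.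
  by rewrite /below /= lt_max => ->; rewrite orbT.
by move=> _ [->|->] z; [move=> ->|move=> [->|->]].
Qed.

(* The restrictions to [below x] of all the functions are coded by elements of
   [L]: the code [c] of a graph is chosen by injecting the powerset of
   [seqs (below x)] into [L]. *)
Lemma ex_decoder (kappa : L) : infinite_set (below kappa) ->
  exists g : L -> L -> seq L -> L, forall x (h : seq L -> L), exists c,
    forall t, seqs (below x) t -> h t < x -> g x c t = h t.
Proof.
move=> infK.
have ex x : exists E : set (seq L) -> L,
    {in subsets (seqs (below x)) &, injective E}.
  have [ltE _] := card_lt_subsets (card_lt_seqs_below x infK).
  have [|E [Einj _]] := card_le_exinj _ ltE; last by exists E.
  by exists set0; exact: sub0set.
have [E Einj] := choice ex.
(* With the value put in front of its argument, a graph is itself a set of sequences below [x], so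
   [E x] can code it. *)
pose graph x (h : seq L -> L) := [set u | exists t,
  [/\ u = h t :: t, seqs (below x) t & h t < x]].
have graphS x h : graph x h \in subsets (seqs (below x)).
  apply/mem_set => _ [t [-> tx hx]] y /=.
  by rewrite inE => /orP[/eqP->//|]; exact: tx.
(* Decoding looks for any graph with code [c]; injectivity of [E x] makes the value found
   independent of the choice of [h]. *)
exists (fun x c t => xget x [set v | exists h, E x (graph x h) = c /\
   graph x h (v :: t)]) => x h.
exists (E x (graph x h)) => t tx hx.
apply: xget_unique.
  by exists h; split=> //; exists t.
move=> v [h' [/Einj -> //]].
by move=> [t' [[-> ->]]].
Qed.

End StrongLimit.

End WellOrdered.

(** * The stationary set and its unbounded subsets *)

Lemma seq_ub (d : Order.disp_t) (L : orderType d) (x0 : L) (s : seq L) :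
  exists m, forall y, y \in s -> y <= m.
Proof.
elim: s => [|x s [m mP]]; first by exists x0.
exists (Order.max x m) => y; rewrite inE => /orP[/eqP->|/mP ym].
  by rewrite le_max lexx.
by rewrite le_max ym orbT.
Qed.

Theorem theorem1p4 (d : Order.disp_t) (lambda : orderType d)
    (sigma kappa : lambda)
    (lambda_wo : well_order (@Order.le d lambda))
    (lambda_singular : singular_cardinal [set: lambda]%classic)
    (lambda_strong_limit : strong_limit_cardinal [set: lambda]%classic)
    (lambda_cf : has_cf [set: lambda]%classic (below sigma))
    (kappa_regular : regular_cardinal (below kappa))
    (sigma_lt_kappa : (sigma < kappa)%O) :
  exists S : set (Pkl kappa),
    stationary S /\
    forall T : set (Pkl kappa),
      (T `<=` S)%classic -> unbounded T -> stationary T.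
Proof.
have no_max := strong_limit_no_max lambda_wo lambda_strong_limit.
have [cardK infK _] := kappa_regular.
have [_ [X [_ cofX] Xsigma] _] := lambda_cf.
have cofX' x : exists2 y, X y & x < y.
  have [z xz] := no_max x; have [y Xy zy] := cofX z I.
  by exists y => //; exact: lt_le_trans zy.
have ltX : card_lt X (below kappa).
  by apply: card_le_lt (proj2 cardK _ sigma_lt_kappa); case/card_eqPle: Xsigma.
(* [X] has no upper bound, so it is infinite; since [kappa] is larger than [X], it is
   uncountable. *)
have natK : card_lt [set: nat] (below kappa).
  apply: card_le_lt ltX; apply/infiniteP => /finite_seqP[s Xs].
  have [m mP] := seq_ub kappa s.
  have [y + my] := cofX' m; rewrite Xs => /mP.
  by rewrite leNgt my.
have [g gP] := ex_decoder lambda_wo lambda_strong_limit infK.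
pose S : set (Pkl kappa) := [set b |
  (forall x c t, sval b x -> sval b c -> seqs (sval b) t -> sval b (g x c t)) /\
  exists2 z, z < kappa & sval b `&` below kappa = below z].
have unbS : unbounded S.
  move=> [a lta].
  have [b [ab ltb bg bz]] :=
    ex_closed_superset lambda_wo g kappa_regular natK lta.
  by exists (exist _ b ltb).
(* [F] is visibly a filter, which saves intersecting clubs by merging models. *)
pose F : set (set (Pkl kappa)) :=
  [set Y | exists a : Pkl kappa, forall b, S b -> sval a `<=` sval b -> Y b].
have FF : Filter F.
  split.
  - by exists (exist _ X ltX).
  - move=> P Q [[a lta] aP] [[b ltb] bQ].
    exists (exist _ (a `|` b) (card_lt_setU lambda_wo kappa_regular natK lta ltb)).
    move=> c Sc /=; rewrite subUset => -[ac bc]; split; [exact: aP|exact: bQ].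
  - by move=> P Q PQ [a aP]; exists a => b Sb ab; apply: PQ; exact: aP.
have clubF : is_club (kappa := kappa) `<=` F.
  move=> _ [M ->].
  (* Each function of [M] is extended to all sequences, with the dummy value [kappa] at wrong
     lengths. *)
  pose h (f : fun_symb (voc M)) (t : seq lambda) :=
    if insub t is Some u then @fun_interp _ M f u else kappa.
  have [code codeP] :=
    choice (fun p : fun_symb (voc M) * lambda => gP p.2 (h p.1)).
  (* Besides the codes, [a] contains the bounds in [X], since decoding takes both as arguments. *)
  pose a := X `|` \bigcup_(f in [set: fun_symb (voc M)])
    ((fun x => code (f, x)) @` X).
  have lta : card_lt a (below kappa).
    apply: card_lt_setU => //; apply: card_lt_bigcup => //.
      exact: card_lt_countable natK (countableP _).
    by move=> f _; exact: card_le_lt (card_image_le _ _) ltX.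
  exists (exist _ a lta) => b [bg bz] /= ab; split=> //.
  rewrite /cl smallest_id // => f t bt.
  (* A bound [x] in [X] above the arguments and the value makes the code for [x] return the true
     value. *)
  have [m mP] := seq_ub (fun_interp t) (fun_interp t :: t).
  have [x Xx mx] := cofX' m.
  have ht : h f t = fun_interp t by rewrite /h valK.
  have <- : g x (code (f, x)) t = fun_interp t.
    rewrite -ht (codeP (f, x)) //=; last first.
      by rewrite ht; apply: le_lt_trans mx; apply: mP; rewrite inE eqxx.
    move=> y yt; apply: le_lt_trans mx; apply: mP.
    by rewrite inE; apply/orP; right.
  apply: bg.
  - by apply: ab; left.
  - by apply: ab; right; exists f => //; exists x.
  - by move=> y /= /tnthP[i ->].
(* If the complement of [T] were in the club filter, it would be in [F]: all members of [S] above
   some [a] would avoid [T], but [T] has a member above [a]. *)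
have unb_stat T : T `<=` S -> unbounded T -> stationary T.
  move=> TS unbT /(smallest_sub FF clubF)[a aT].
  by have [b Tb ab] := unbT a; exact: (aT b (TS b Tb) ab).
by exists S; split=> //; exact: unb_stat.
Qed.
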